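(* Let $f:\mathbb{R}^n\to\mathbb{R}$, $g:\mathbb{R}^n\to(-\infty,\infty]$, $L>0$, $l\in\mathbb{R}$ and $\gamma>0$ satisfy the standing assumptions in the context, and let $\{(y^t,z^t,x^t)\}_{t\ge1}$ be any sequence generated by the Douglas-Rachford splitting method (defined in the context) with step-size parameter $\gamma$ from an initial point $x^0\in\mathbb{R}^n$. Suppose that $$(1+\gamma L)^2+\frac{5\gamma l}{2}-\frac32<0 .$$ Then $\{\mathfrak{D}_\gamma(y^t,z^t,x^t)\}_{t\ge 1}$ is nonincreasing, where $\mathfrak{D}_\gamma$ is the Douglas-Rachford merit function defined in the context. Moreover, if a cluster point of the sequence $\{(y^t,z^t,x^t)\}$ exists, then $$\lim_{t\to\infty}\|x^{t+1}-x^t\|=\lim_{t\to\infty}\|z^{t+1}-y^{t+1}\|=0 .$$ Furthermore, for any cluster point $(y^*,z^*,x^* )$ of the sequence, we have $z^*=y^*$ and $$0\in\nabla f(z^* )+\partial g(z^* ).$$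
   Context: Standing assumptions. $f:\mathbb{R}^n\to\mathbb{R}$ is continuously differentiable and $\nabla f$ is Lipschitz continuous with a Lipschitz modulus bounded by $L>0$. $l\in\mathbb{R}$ is such that $f+\frac l2\|\cdot\|^2$ is convex. $g:\mathbb{R}^n\to(-\infty,\infty]$ is proper (its domain $\{g<+\infty\}$ is nonempty) and closed (lower semicontinuous). For the given $\gamma>0$ and every $w\in\mathbb{R}^n$, the problem $\min_u\{\gamma g(u)+\frac12\|u-w\|^2\}$ has a minimizer. Douglas-Rachford splitting method. Given $x^0\in\mathbb{R}^n$ and $\gamma>0$, for $t=0,1,2,\dots$ choose $$y^{t+1}\in\operatorname{Arg\,min}_y\Big\{f(y)+\tfrac1{2\gamma}\|y-x^t\|^2\Big\},\quad z^{t+1}\in\operatorname{Arg\,min}_z\Big\{g(z)+\tfrac1{2\gamma}\|2y^{t+1}-x^t-z\|^2\Big\},\quad x^{t+1}=x^t+(z^{t+1}-y^{t+1}).$$ Douglas-Rachford merit function: $$\mathfrak{D}_\gamma(y,z,x)=f(y)+g(z)-\frac1{2\gamma}\|y-z\|^2+\frac1\gamma\langle x-y,z-y\rangle .$$ Subdifferential. For a proper function $h$ and $x$ with $h(x)<\infty$, $\partial h(x)$ is the limiting subdifferential: the set of $v$ for which there exist $x^k\to x$ with $h(x^k)\to h(x)$ and $v^k\to v$ such that $\liminf_{z\to x^k}\frac{h(z)-h(x^k)-\langle v^k,z-x^k\rangle}{\|z-x^k\|}\ge0$ for each $k$. *)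

(* Defs.v *)
From HB Require Import structures.
From mathcomp Require Export all_boot all_order all_algebra.
From mathcomp Require Export all_classical all_reals all_analysis.
Export numFieldNormedType.Exports.

Set Implicit Arguments.
Unset Strict Implicit.
Unset Printing Implicit Defensive.

Import Order.TTheory GRing.Theory Num.Theory.

Local Open Scope classical_set_scope.
Local Open Scope ring_scope.

(* R^n is 'rV[R]_n.  Its library norm `|_| is the sup norm, so the Euclidean
   structure is defined here; the sup norm is only used through the topology
   and the notion of differentiability, which do not depend on the choice. *)
Definition dot (R : realType) (n : nat) (u v : 'rV[R]_n) : R :=
  \sum_(i < n) u 0 i * v 0 i.

Definition enorm (R : realType) (n : nat) (u : 'rV[R]_n) : R :=
  Num.sqrt (dot u u).

Definition gradient (R : realType) (n : nat) (f : 'rV[R]_n -> R)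
    (u : 'rV[R]_n) : 'rV[R]_n :=
  \row_(i < n) 'd f u (delta_mx 0 i).

Definition argmin (T : Type) (d : Order.disp_t) (U : porderType d)
    (F : T -> U) : set T :=
  [set u | forall v, (F u <= F v)%O].

Definition proper (T : Type) (R : realType) (g : T -> \bar R) : Prop :=
  (forall u, g u != -oo%E) /\ (exists u, (g u < +oo)%E).

(* The difference quotient is only meaningful where h is finite; there are no
   subgradients elsewhere.  The filter u^' excludes the point u itself. *)
Definition frechet_subdiff (R : realType) (n : nat) (h : 'rV[R]_n -> \bar R)
    (u : 'rV[R]_n) : set 'rV[R]_n :=
  [set v | h u \is a fin_num /\
    (0%E <= limf_einf (fun w : 'rV[R]_n =>
       (h w - h u - (dot v (w - u))%:E) * ((enorm (w - u))^-1)%:E) u^')%E].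

Definition limiting_subdiff (R : realType) (n : nat) (h : 'rV[R]_n -> \bar R)
    (u : 'rV[R]_n) : set 'rV[R]_n :=
  [set v | h u \is a fin_num /\
    exists (uk vk : nat -> 'rV[R]_n),
      [/\ uk k @[k --> \oo] --> u,
          h (uk k) @[k --> \oo] --> h u,
          vk k @[k --> \oo] --> v &
          forall k, frechet_subdiff h (uk k) (vk k)]].

(* y 0 and z 0 are not part of the method and are left unconstrained. *)
Definition DR_sequence (R : realType) (n : nat) (f : 'rV[R]_n -> R)
    (g : 'rV[R]_n -> \bar R) (gamma : R) (x0 : 'rV[R]_n)
    (y z x : nat -> 'rV[R]_n) : Prop :=
  x 0%N = x0 /\
  forall t : nat,
    [/\ argmin (fun u => f u + (2 * gamma)^-1 * enorm (u - x t) ^+ 2) (y t.+1),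
        argmin (fun u => (g u + ((2 * gamma)^-1 *
                  enorm (2 *: y t.+1 - x t - u) ^+ 2)%:E)%E) (z t.+1) &
        x t.+1 = x t + (z t.+1 - y t.+1)].

Definition DR_merit (R : realType) (n : nat) (f : 'rV[R]_n -> R)
    (g : 'rV[R]_n -> \bar R) (gamma : R) (y z x : 'rV[R]_n) : \bar R :=
  ((f y)%:E + g z - ((2 * gamma)^-1 * enorm (y - z) ^+ 2)%:E
    + (gamma^-1 * dot (x - y) (z - y))%:E)%E.

(* Main.v *)
Require Import Defs.
From mathcomp Require Import ring lra.
Import Order.TTheory GRing.Theory Num.Theory.
Local Open Scope classical_set_scope.
Local Open Scope ring_scope.
Set Implicit Arguments.
Unset Strict Implicit.
Unset Printing Implicit Defensive.

(** Write [d] and [e] for the increments of [y t] and of [gradient f (y t)]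
    over one iteration.  Optimality of the y-step says that
    [x t = y t.+1 + gamma *: gradient f (y t.+1)], so everything an iteration
    does is expressed by [d], [e] and [x t.+1 - x t = d + gamma *: e].

    The merit function is a Lyapunov function.  Weak convexity of [f] bounds
    the gain of the y-step and minimality bounds the gain of the z-step; once
    these two inequalities are substituted, all terms containing the new
    displacement [z t.+2 - y t.+2] cancel, and the merit changes by at most
    [gamma * |e|^2 + (l / 2 - 1 / (2 * gamma)) * |d|^2], where [|e| <= L * |d|].
    Since [- l * |d|^2 <= dot d e <= L * |d|^2], this is at most
    [(((1 + gamma * L)^2 + 5 * gamma * l / 2 - 3 / 2) / gamma) * |d|^2]
    ([merit_decrease], [DR_decrease]), a negative multiple of [|d|^2] under the
    condition on [gamma].

    If a cluster point exists, the iterates converge to it along some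
    subsequence.  The vectors at which the proximal map of [g] is taken then
    converge too, and the graph of the proximal map is closed, the values of
    [g] converging along it ([prox_closed]).  Hence the merit converges to a
    finite limit along the subsequence; being monotone it is bounded below, so
    [d] tends to 0, and with it [x t.+1 - x t = z t.+1 - y t.+1].

    Finally [(2 *: y t.+1 - x t - z t.+1) / gamma] is a Frechet subgradient of
    [g] at [z t.+1] ([prox_frechet]).  In the limit it becomes a limiting
    subgradient, and the limit of the optimality condition of the y-step
    identifies it with [- gradient f zs]. *)

(** * The Euclidean structure of row vectors *)

Section Euclid.
Variables (R : realType) (n : nat).
Implicit Types (u v w d : 'rV[R]_n) (a : R).

Lemma dotC u v : dot u v = dot v u.
Proof. by apply: eq_bigr => i _; rewrite mulrC. Qed.

Lemma dotDl u v w : dot (u + v) w = dot u w + dot v w.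
Proof. by rewrite /dot -big_split; apply: eq_bigr => i _; rewrite mxE mulrDl. Qed.

Lemma dotZl a u v : dot (a *: u) v = a * dot u v.
Proof. by rewrite /dot mulr_sumr; apply: eq_bigr => i _; rewrite mxE mulrA. Qed.

Lemma dotNl u v : dot (- u) v = - dot u v.
Proof. by rewrite -scaleN1r dotZl mulN1r. Qed.

Lemma dotDr u v w : dot w (u + v) = dot w u + dot w v.
Proof. by rewrite dotC dotDl !(dotC _ w). Qed.

Lemma dotZr a u v : dot v (a *: u) = a * dot v u.
Proof. by rewrite dotC dotZl dotC. Qed.

Lemma dotNr u v : dot v (- u) = - dot v u.
Proof. by rewrite dotC dotNl dotC. Qed.

Definition dotE := (dotDl, dotDr, dotZl, dotZr, dotNl, dotNr).

Lemma dot_ge0 u : 0 <= dot u u.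
Proof. by apply: sumr_ge0 => i _; rewrite -expr2 sqr_ge0. Qed.

Lemma enorm_sqr u : enorm u ^+ 2 = dot u u.
Proof. by rewrite sqr_sqrtr ?dot_ge0. Qed.

Lemma coord_le_enorm u i : `|u 0 i| <= enorm u.
Proof.
rewrite -sqrtr_sqr ler_sqrt ?dot_ge0// /dot (bigD1 i)//= -expr2 lerDl.
by apply: sumr_ge0 => j _; rewrite -expr2 sqr_ge0.
Qed.

(** The topology comes from the sup norm, so this is what turns Euclidean
    estimates into topological ones. *)
Lemma norm_le_enorm u : `|u| <= enorm u.
Proof.
rewrite /Num.Def.normr/= mx_normrE; apply: bigmax_le; first exact: sqrtr_ge0.
by move=> [i j] _ /=; rewrite ord1 coord_le_enorm.
Qed.

Lemma enorm_gt0 u : u != 0 -> 0 < enorm u.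
Proof. by rewrite -normr_gt0 => /lt_le_trans; apply; exact: norm_le_enorm. Qed.

Lemma dot_le0_eq0 u : dot u u <= 0 -> u = 0.
Proof.
move=> u0; apply/eqP; rewrite -normr_le0 (le_trans (norm_le_enorm u))//.
by rewrite /enorm ler0_sqrtr.
Qed.

Lemma cvg_dot (T : Type) (F : set_system T) {FF : Filter F}
    (a b : T -> 'rV[R]_n) u v :
  a t @[t --> F] --> u -> b t @[t --> F] --> v ->
  dot (a t) (b t) @[t --> F] --> dot u v.
Proof.
move=> au bv; rewrite /dot; apply: (cvg_big add_continuous) => i _.
have coord_cvg (c : T -> 'rV[R]_n) w : c t @[t --> F] --> w ->
    c t 0 i @[t --> F] --> w 0 i.
  move=> cw; apply: (@continuous_cvg _ _ _ _ _ _ (fun M : 'rV[R]_n => M 0 i) _ _ cw).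
  exact: coord_continuous.
by apply: cvgM; exact: coord_cvg.
Qed.

Lemma cvg_enorm (T : Type) (F : set_system T) {FF : Filter F}
    (a : T -> 'rV[R]_n) u :
  a t @[t --> F] --> u -> enorm (a t) @[t --> F] --> enorm u.
Proof.
move=> au; apply: (@continuous_cvg _ _ _ _ _ _ (@Num.sqrt R)).
  exact: sqrt_continuous.
exact: cvg_dot.
Qed.

Lemma enorm0 : enorm (0 : 'rV[R]_n) = 0.
Proof. by rewrite /enorm -(scale0r 0) dotZl mul0r sqrtr0. Qed.

Lemma enorm_cvg0 (T : Type) (F : set_system T) {FF : Filter F}
    (a : T -> 'rV[R]_n) :
  enorm (a t) @[t --> F] --> (0 : R) -> a t @[t --> F] --> (0 : 'rV[R]_n).
Proof.
move=> h; apply/norm_cvg0P; apply: (squeeze_cvgr _ (cvg_cst 0) h).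
by apply: nearW => t; rewrite normr_ge0 norm_le_enorm.
Qed.

Variable f : 'rV[R]_n -> R.

Lemma dot_gradient u d : 'd f u d = dot (gradient f u) d.
Proof.
rewrite [in LHS](row_sum_delta d) linear_sum; apply: eq_bigr => i _ /=.
by rewrite linearZ/= mxE mulrC.
Qed.

(** The limit is one-sided because the minimality and convexity inequalities
    used below compare [f u] with values at [u + s *: d] for small [s > 0]. *)
Lemma cvg_slope u d : differentiable f u ->
  s^-1 * (f (u + s *: d) - f u) @[s --> 0^'+] --> dot (gradient f u) d.
Proof.
move=> df; rewrite -dot_gradient -deriveE//.
apply: cvg_dnbhs_at_right.
have h : s^-1 *: (f (s *: d + u) - f u) @[s --> 0^'] --> 'D_d f u.
  exact: diff_derivable.
apply: cvg_trans h; apply: near_eq_cvg; apply: nearW => s /=.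
by rewrite [u + _]addrC.
Qed.
End Euclid.

(** * First-order inequalities for smooth functions *)

Section Smooth.
Variables (R : realType) (n : nat) (f : 'rV[R]_n -> R).
Implicit Types (u v w d : 'rV[R]_n) (a b l gamma : R).

Lemma cvg_slope_affine u d b : differentiable f u ->
  s^-1 * (f (u + s *: d) - f u) - b * s @[s --> 0^'+]
    --> dot (gradient f u) d.
Proof.
move=> df.
have bs : b * s @[s --> (0 : R)^'+] --> b * 0.
  by apply: cvgMr; apply: cvg_at_right_filter; exact: cvg_id.
by have := cvgB (cvg_slope (d := d) df) bs _; rewrite mulr0 subr0; exact.
Qed.

(** The quadratic term [b * s ^+ 2] disappears in the limit: it absorbs the
    second-order part of a proximal or weak-convexity penalty. *)
Lemma gradient_dot_ge u d a b : differentiable f u ->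
  (forall s, 0 < s <= 1 -> s * (a + b * s) <= f (u + s *: d) - f u) ->
  a <= dot (gradient f u) d.
Proof.
move=> df H; apply: (cvgr_to_ge (cvg_slope_affine (d := d) b df)).
near=> s.
have s0 : 0 < s by near: s; exact: nbhs_right_gt.
have s1 : s <= 1 by near: s; exact: nbhs_right_le.
by rewrite lerBrDr ler_pdivlMl// H// s0 s1.
Unshelve. all: by end_near. Qed.

Lemma gradient_dot_le u d a b : differentiable f u ->
  (forall s, 0 < s <= 1 -> f (u + s *: d) - f u <= s * (a + b * s)) ->
  dot (gradient f u) d <= a.
Proof.
move=> df H; apply: (cvgr_to_le (cvg_slope_affine (d := d) b df)).
near=> s.
have s0 : 0 < s by near: s; exact: nbhs_right_gt.
have s1 : s <= 1 by near: s; exact: nbhs_right_le.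
by rewrite lerBlDr ler_pdivrMl// H// s0 s1.
Unshelve. all: by end_near. Qed.

Lemma prox_stationary gamma x y : 0 < gamma -> differentiable f y ->
  argmin (fun u => f u + (2 * gamma)^-1 * enorm (u - x) ^+ 2) y ->
  x = y + gamma *: gradient f y.
Proof.
move=> g0 df ymin.
(* The expansion of the penalty at y + s *: d is affine plus quadratic in s,
   which is the form gradient_dot_ge accepts. *)
have ge d : - gamma^-1 * dot (y - x) d <= dot (gradient f y) d.
  apply: (gradient_dot_ge (b := - (2 * gamma)^-1 * dot d d)) => // s _.
  have := ymin (y + s *: d).
  rewrite (_ : y + s *: d - x = (y - x) + s *: d); last by rewrite addrAC.
  move: (y - x) => p.
  rewrite !enorm_sqr !dotE (dotC d p) => h; rewrite -subr_ge0 in h.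
  rewrite -subr_ge0; apply: le_trans h _; rewrite le_eqVlt; apply/predU1P; left.
  by field; rewrite gt_eqF.
set e := gradient f y + gamma^-1 *: (y - x).
(* The inequality of ge in the direction - e reads - |e|^2 >= 0. *)
have e0 : e = 0.
  apply: dot_le0_eq0; have := ge (- e).
  by rewrite {2 4}/e !dotE; lra.
have -> : x = y + gamma *: (gradient f y - e).
  rewrite /e opprD addrA subrr add0r scalerN scalerA.
  by rewrite divff ?gt_eqF// scale1r opprB addrC subrK.
by rewrite e0 subr0.
Qed.

Hypothesis f_diff : forall u, differentiable f u.

(** Along the segment from [u] to [v], convexity of [f + l / 2 * |.|^2] leaves
    the defect [l / 2 * s * (1 - s) * |v - u|^2], of slope
    [l / 2 * |v - u|^2] at [s = 0]. *)
Lemma weakly_convex_gradient l :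
  @convex_function R 'rV[R]_n [set: 'rV[R]_n]
       (fun u => f u + l / 2 * enorm u ^+ 2) ->
  forall u v,
  f u + dot (gradient f u) (v - u) - l / 2 * dot (v - u) (v - u) <= f v.
Proof.
move=> cvx u v; set d := v - u.
suff : dot (gradient f u) d <= f v - f u + l / 2 * dot d d by lra.
apply: (gradient_dot_le (b := - (l / 2 * dot d d))) => // s /andP[s0 s1].
have h : f (s *: v + (1 - s) *: u)
      + l / 2 * enorm (s *: v + (1 - s) *: u) ^+ 2 <=
    s * (f v + l / 2 * enorm v ^+ 2) + (1 - s) * (f u + l / 2 * enorm u ^+ 2).
  by have := cvx (Itv01 (ltW s0) s1) v u; rewrite !inE => /(_ I I).
have segE : s *: v + (1 - s) *: u = u + s *: d.
  by rewrite /d; apply/rowP => i; rewrite !mxE; ring.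
have vE : v = u + d by rewrite /d addrC subrK.
move: h; rewrite segE [in enorm v]vE !enorm_sqr !dotE (dotC v u).
lra.
Qed.

(** Sum of the two first-order inequalities obtained by exchanging [u] and
    [v]. *)
Lemma weakly_convex_hypomonotone l :
  (forall u v,
    f u + dot (gradient f u) (v - u) - l / 2 * dot (v - u) (v - u) <= f v) ->
  forall u v,
  - l * dot (v - u) (v - u) <= dot (v - u) (gradient f v - gradient f u).
Proof.
move=> H u v; move: (H u v) (H v u); rewrite -(opprB v u).
move: (v - u) (gradient f u) (gradient f v) => d a b.
rewrite !dotE (dotC d a) (dotC d b); lra.
Qed.

End Smooth.

(** * One iteration decreases the merit *)

Section Step.
Variables (R : realType) (n : nat).
Implicit Types (d e a b q y z x : 'rV[R]_n).

(** The real-valued form of [DR_merit], in which [F] and [G] stand for the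
    values of the two objective functions. *)
Definition merit (F G gamma : R) y z x : R :=
  F + G - (2 * gamma)^-1 * enorm (y - z) ^+ 2 + gamma^-1 * dot (x - y) (z - y).

(** Young's inequality, from [|L *: d - e|^2 >= 0], gives the constant that
    Cauchy-Schwarz would give. *)
Lemma lip_dot_le (L : R) d e : 0 < L -> dot e e <= L ^+ 2 * dot d d ->
  dot d e <= L * dot d d.
Proof.
move=> L0 le; have := dot_ge0 (L *: d - e); rewrite !dotE (dotC e d) => h.
rewrite -(ler_pM2l L0); lra.
Qed.

(** Here [b] and [b'] are the gradients at [y] and [y'].  Put [d = y' - y],
    [e = b' - b] and [q = z' - y'].  All the vectors involved are combinations
    of [d], [e], [b'] and [q], and the claim is the sum of the first-order
    inequality for [F], the minimality inequality for [G], [gamma] times the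
    Lipschitz inequality and [0 <= 2 * (L + l) * |d|^2]; the terms in [q] and
    [b'] cancel. *)
Lemma merit_decrease (gamma L l F F' G G' : R) y y' z z' x b b' :
  0 < gamma -> 0 < L ->
  y + gamma *: b + (z - y) = x ->
  x = y' + gamma *: b' ->
  F' + dot b' (y - y') - l / 2 * dot (y - y') (y - y') <= F ->
  - l * dot (y' - y) (y' - y) <= dot (y' - y) (b' - b) ->
  dot (b' - b) (b' - b) <= L ^+ 2 * dot (y' - y) (y' - y) ->
  G' + (2 * gamma)^-1 * enorm (2 *: y' - x - z') ^+ 2 <=
  G + (2 * gamma)^-1 * enorm (2 *: y' - x - z) ^+ 2 ->
  merit F' G' gamma y' z' (x + (z' - y')) - merit F G gamma y z x <=
  ((1 + gamma * L) ^+ 2 + 5 * gamma * l / 2 - 3 / 2) / gamma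
    * dot (y' - y) (y' - y).
Proof.
move=> g0 L0 xE xE' Fle mono lip Gle.
set d := y' - y in mono lip *; set e := b' - b in mono lip *.
pose q := z' - y'.
have zE : z = y + d + gamma *: e.
  apply: (addrI (y + gamma *: b - y)).
  rewrite [LHS](_ : _ = x); last by rewrite -xE -!addrA [-y + z]addrC.
  rewrite xE' /d /e scalerBr [y + (y' - y)]addrC subrK.
  by apply/rowP => i; rewrite !mxE; ring.
have y'E : y' = y + d by rewrite /d addrC subrK.
have z'E : z' = y + d + q by rewrite -y'E /q addrC subrK.
rewrite (_ : y - y' = - d) in Fle; last by rewrite /d opprB.
have e1 : 2 *: y' - x - z' = - (gamma *: b' + q).
  by rewrite xE' z'E y'E; apply/rowP => i; rewrite !mxE; ring.
have e2 : 2 *: y' - x - z = - (gamma *: b' + gamma *: e).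
  by rewrite xE' zE y'E; apply/rowP => i; rewrite !mxE; ring.
have e3 : y' - z' = - q by rewrite /q opprB.
have e4 : x + (z' - y') - y' = gamma *: b' + q.
  by rewrite xE' -/q; apply/rowP => i; rewrite !mxE; ring.
have e5 : y - z = - (d + gamma *: e).
  by rewrite zE; apply/rowP => i; rewrite !mxE; ring.
have e6 : x - y = d + gamma *: b'.
  by rewrite xE' y'E; apply/rowP => i; rewrite !mxE; ring.
have e7 : z - y = d + gamma *: e by rewrite -opprB e5 opprK.
rewrite /merit e4 e3 e5 e6 e7 -/q !enorm_sqr.
rewrite e1 e2 !enorm_sqr in Gle.
have ee : dot d e <= L * dot d d by exact: lip_dot_le.
(* As local definitions, d, e and q would be unfolded by the bilinearity
   rules. *)
clearbody d e q.
rewrite !dotE in Fle Gle mono lip ee *.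
rewrite ?(dotC q b') ?(dotC e b') ?(dotC e d) ?(dotC b' d) in Fle Gle mono lip ee *.
have lip' : 0 <= gamma * (L ^+ 2 * dot d d - dot e e).
  by rewrite mulr_ge0 ?subr_ge0// ltW.
have dle : 0 <= 2 * (L * dot d d + l * dot d d) by lra.
rewrite -subr_ge0 in Fle; rewrite -subr_ge0 in Gle; rewrite -subr_ge0.
(* The right-hand side minus the left-hand side is exactly the sum of the four
   slacks. *)
apply: le_trans (addr_ge0 (addr_ge0 Fle Gle) (addr_ge0 lip' dle)) _.
rewrite le_eqVlt; apply/predU1P; left.
by field; rewrite gt_eqF.
Qed.
End Step.

(** * Subsequences and monotone sequences *)

(** The indices satisfy [k <= phi k] instead of being strictly increasing:
    this suffices for [phi] to tend to infinity. *)
Lemma cluster_subsequence (R : realType) (T : pseudoMetricType R)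
    (u : nat -> T) (p : T) :
  cluster (u t @[t --> \oo]) p ->
  exists phi : nat -> nat,
    (forall k, (k <= phi k)%N) /\ u (phi k) @[k --> \oo] --> p.
Proof.
move=> up.
have H k : exists t, (k <= t)%N /\ ball p k.+1%:R^-1 (u t).
  have [] := up [set u t | t in [set t | (k <= t)%N]] (ball p k.+1%:R^-1).
  - by exists k => // t /= kt; exists t.
  - by apply: nbhsx_ballx; rewrite invr_gt0.
  - by move=> _ [[t /= kt <-]] ?; exists t.
have [phi Hphi] := choice H; exists phi; split=> [k|]; first by have [] := Hphi k.
apply/cvg_ballP => e e0; near=> k.
apply: (@le_ball _ _ _ k.+1%:R^-1); last by have [] := Hphi k.
by apply: ltW; near: k; exact: (near_infty_natSinv_lt (PosNum e0)).
Unshelve. all: by end_near. Qed.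

Lemma le_cvg_infty (phi : nat -> nat) :
  (forall k, (k <= phi k)%N) -> phi k @[k --> \oo] --> \oo.
Proof.
move=> phi_ge P [N _ NP]; exists N => // k /= Nk.
exact/NP/(leq_trans Nk)/phi_ge.
Qed.

Lemma nonincreasing_sub_cvg0 (R : realType) (M : R^nat) (m : R) :
  nonincreasing_seq M -> (forall t, m <= M t) ->
  M t - M t.+1 @[t --> \oo] --> (0 : R).
Proof.
move=> ni mM.
have cM : cvgn M.
  by apply: nonincreasing_is_cvgn => //; exists m => _ [t _ <-].
rewrite -(subrr (limn M)); apply: cvgB => //.
by have := cM; rewrite -cvg_shiftS.
Qed.

(** * The proximal map *)

Section Prox.
Variables (R : realType) (n : nat) (g : 'rV[R]_n -> \bar R) (gamma : R).
Hypotheses (gamma_gt0 : 0 < gamma) (g_proper : proper g).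
Implicit Types (u w z : 'rV[R]_n).

Let prox w : set 'rV[R]_n :=
  argmin (fun u => (g u + ((2 * gamma)^-1 * enorm (w - u) ^+ 2)%:E)%E).

Lemma prox_fin_num w z : prox w z -> g z \is a fin_num.
Proof.
have [gNy [u gu]] := g_proper.
rewrite fin_numE gNy/= -ltey => /(_ u) h; move: gu.
by move: h; case: (g z) => [s| |] //=; case: (g u) => [r| |] //=; rewrite !ltry.
Qed.

Lemma prox_le w z u : prox w z -> g u \is a fin_num ->
  fine (g z) + (2 * gamma)^-1 * enorm (w - z) ^+ 2 <=
  fine (g u) + (2 * gamma)^-1 * enorm (w - u) ^+ 2.
Proof.
move=> wz gu; have := wz u; have := prox_fin_num wz.
by case: (g z) => // r _; case: (g u) gu => // s _; rewrite lee_fin.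
Qed.

(** Expanding the squares in the minimality inequality gives
    [g u >= g z + dot ((w - z) / gamma) (u - z) - |u - z|^2 / (2 * gamma)], and
    the last term is of second order. *)
Lemma prox_frechet w z : prox w z ->
  frechet_subdiff g z (gamma^-1 *: (w - z)).
Proof.
move=> wz; split; first exact: (prox_fin_num wz).
have gz := prox_fin_num wz; have [gNy _] := g_proper.
rewrite /limf_einf oppe_ge0 /limf_esup.
apply/lee_addgt0Pr => e e0; rewrite add0e.
(* On this punctured neighbourhood the second-order term is at most e * |u - z|. *)
pose V : set 'rV[R]_n := [set u | u != z /\ enorm (u - z) <= 2 * gamma * e].
have FV : z^' V.
  have subz : (u - z : 'rV[R]_n) @[u --> nbhs z] --> z - z.
    by apply: (@cvgB R 'rV[R]_n _ (nbhs z)); [exact: cvg_id|exact: cvg_cst].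
  have cvg0 : enorm (u - z) @[u --> nbhs z] --> (0 : R).
    by rewrite -(@enorm0 R n) -(subrr z); exact: cvg_enorm subz.
  have ge0 : 0 < 2 * gamma * e by rewrite !mulr_gt0.
  have near_le : \forall u \near z, enorm (u - z) <= 2 * gamma * e.
    exact: cvgr_le cvg0 _ ge0.
  rewrite /V; near=> u; split; first by near: u; exact: nbhs_dnbhs_neq.
  by near: u; exact: nbhs_dnbhs near_le.
apply: (@le_trans _ _ (ereal_sup
  [set (\- (fun u => (g u - g z - (dot (gamma^-1 *: (w - z)) (u - z))%:E)
      * ((enorm (u - z))^-1)%:E))%E u | u in V])).
  by apply: ereal_inf_lbound; exists V.
apply: ge_ereal_sup => _ [u [uz ule] <-].
rewrite leeNl.
have N0 : 0 < enorm (u - z) by rewrite enorm_gt0// subr_eq0.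
have /= := gNy u.
case: (g u) (prox_le wz (u := u)) => [r| |//] h _; last first.
  by rewrite -(fineK gz) /= mulyr gtr0_sg ?invr_gt0// mul1e leey.
move/(_ isT): h; rewrite -(fineK gz) /= -!EFinB -EFinM lee_fin.
rewrite ler_pdivlMr// (_ : w - u = (w - z) - (u - z)); last first.
  by rewrite opprB addrA subrK.
have eN : (2 * gamma)^-1 * enorm (u - z) ^+ 2 <= e * enorm (u - z).
  by rewrite ler_pdivrMl ?mulr_gt0// mulrA expr2 ler_pM2r.
move: eN; rewrite !enorm_sqr; move: (w - z) (u - z) => p d.
rewrite !dotE (dotC d p) => eN h.
rewrite -subr_ge0 in h; rewrite -subr_ge0 in eN; rewrite -subr_ge0.
apply: le_trans (addr_ge0 h eN) _; rewrite le_eqVlt; apply/predU1P; left.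
by field; rewrite gt_eqF.
Unshelve. all: by end_near. Qed.
End Prox.

(** Lower semicontinuity bounds the limit of [g (z k)] from below.  Comparing
    [z k] with a fixed [u] bounds [g (z k)] from above by a convergent sequence
    ([cB]): a feasible [u] shows that [g zs] is finite, and [u = zs] gives the
    matching upper bound, because the two penalties then have the same limit. *)
Lemma prox_closed (R : realType) (n : nat) (g : 'rV[R]_n -> \bar R) (gamma : R)
    (w z : nat -> 'rV[R]_n) (ws zs : 'rV[R]_n) :
  proper g -> lower_semicontinuous g ->
  (forall k, argmin (fun u =>
    (g u + ((2 * gamma)^-1 * enorm (w k - u) ^+ 2)%:E)%E) (z k)) ->
  w k @[k --> \oo] --> ws -> z k @[k --> \oo] --> zs ->
  g zs \is a fin_num /\ fine (g (z k)) @[k --> \oo] --> fine (g zs).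
Proof.
move=> gP gL wz cw cz.
have lsc a : (a%:E < g zs)%E -> \forall k \near \oo, a < fine (g (z k)).
  move=> /gL[V Vz VP]; have VzP : \forall k \near \oo, V (z k) by exact: cz.
  apply: filterS VzP => k /= /VP.
  by rewrite -{1}(fineK (prox_fin_num gP (wz k))) lte_fin.
have cB u : fine (g u) + (2 * gamma)^-1 * enorm (w k - u) ^+ 2
    - (2 * gamma)^-1 * enorm (w k - z k) ^+ 2 @[k --> \oo] -->
    fine (g u) + (2 * gamma)^-1 * enorm (ws - u) ^+ 2
    - (2 * gamma)^-1 * enorm (ws - zs) ^+ 2.
  have sq (v : nat -> 'rV[R]_n) (vs : 'rV[R]_n) : v k @[k --> \oo] --> vs ->
    (2 * gamma)^-1 * enorm (w k - v k) ^+ 2 @[k --> \oo] -->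
    (2 * gamma)^-1 * enorm (ws - vs) ^+ 2.
    move=> cv; apply: cvgMr; rewrite enorm_sqr.
    under eq_fun do rewrite enorm_sqr.
    have cwv : w k - v k @[k --> \oo] --> ws - vs by apply: cvgB.
    exact: cvg_dot.
  apply: cvgB; last exact: sq.
  by apply: cvgD; [exact: cvg_cst|apply: (sq (fun=> u)); exact: cvg_cst].
have up u : g u \is a fin_num -> forall k, fine (g (z k)) <=
    fine (g u) + (2 * gamma)^-1 * enorm (w k - u) ^+ 2
    - (2 * gamma)^-1 * enorm (w k - z k) ^+ 2.
  by move=> gu k; rewrite lerBrDr; exact: (prox_le gP (wz k) gu).
have gfin : g zs \is a fin_num.
  (* If g zs = +oo, the values g (z k) eventually exceed B + 1, where B is the
     limit of their upper bounds. *)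
  have [gNy [u gu]] := gP.
  have gu' : g u \is a fin_num by rewrite fin_numE gNy -ltey.
  rewrite fin_numE gNy; apply/eqP => gy.
  move: (_ - _) (cB u) => B cBu.
  have h1 := lsc (B + 1); rewrite gy ltry in h1.
  have h2 := cvgr_lt _ cBu (B + 1); rewrite ltrDl ltr01 in h2.
  have [k [/= k1 k2]] := filter_ex (filterI (h1 isT) (h2 _ isT)).
  by have := lt_trans k1 (le_lt_trans (up _ gu' k) k2); rewrite ltxx.
split=> //; apply/cvgrPdist_lt => e e0.
have h1 : \forall k \near \oo, fine (g zs) - e < fine (g (z k)).
  by apply: lsc; rewrite -{2}(fineK gfin) lte_fin ltrBlDr ltrDl.
have h2 := cvgr_lt _ (cB zs) (fine (g zs) + e).
rewrite addrK ltrDl in h2; apply: (filterS _ (filterI h1 (h2 _ e0))) => k /= [k1 k2].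
rewrite ltr_norml.
by have := le_lt_trans (up _ gfin k) k2; lra.
Qed.

(** * The Douglas-Rachford iterates *)

Lemma DR_meritE (R : realType) (n : nat) (f : 'rV[R]_n -> R) g gamma
    (y z x : 'rV[R]_n) : g z \is a fin_num ->
  DR_merit f g gamma y z x = (merit (f y) (fine (g z)) gamma y z x)%:E.
Proof. by move=> gz; rewrite /DR_merit /merit -{1}(fineK gz). Qed.

Lemma cvg_merit (R : realType) (n : nat) (T : Type) (F : set_system T)
    {FF : Filter F} (gamma : R) (a b : T -> R) (y z x : T -> 'rV[R]_n)
    (as_ bs : R) (ys zs xs : 'rV[R]_n) :
  a t @[t --> F] --> as_ -> b t @[t --> F] --> bs ->
  y t @[t --> F] --> ys -> z t @[t --> F] --> zs -> x t @[t --> F] --> xs ->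
  merit (a t) (b t) gamma (y t) (z t) (x t) @[t --> F] -->
  merit as_ bs gamma ys zs xs.
Proof.
move=> ca cb cy cz cx; apply: cvgD; last first.
  by apply: cvgMr; apply: cvg_dot; apply: cvgB.
apply: cvgB; first exact: cvgD.
apply: cvgMr; rewrite enorm_sqr; under eq_fun do rewrite enorm_sqr.
by apply: cvg_dot; apply: cvgB.
Qed.

Section Iterates.
Variables (R : realType) (n : nat) (f : 'rV[R]_n -> R) (g : 'rV[R]_n -> \bar R).
Variables (L l gamma : R) (x0 : 'rV[R]_n) (y z x : nat -> 'rV[R]_n).
Hypotheses (L_gt0 : 0 < L) (gamma_gt0 : 0 < gamma).
Hypothesis f_diff : forall u, differentiable f u.
Hypothesis f_C1 : continuous (gradient f).
Hypothesis f_lip : forall u v,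
  enorm (gradient f u - gradient f v) <= L * enorm (u - v).
Hypothesis f_cvx : @convex_function R 'rV[R]_n [set: 'rV[R]_n]
  (fun u => f u + l / 2 * enorm u ^+ 2).
Hypotheses (g_proper : proper g) (g_closed : lower_semicontinuous g).
Hypothesis DR : DR_sequence f g gamma x0 y z x.
Hypothesis gamma_small :
  (1 + gamma * L) ^+ 2 + 5 * gamma * l / 2 - 3 / 2 < 0.

Let G t := fine (g (z t.+1)).
Let M t := merit (f (y t.+1)) (G t) gamma (y t.+1) (z t.+1) (x t.+1).

Lemma DR_prox t : argmin (fun u => (g u + ((2 * gamma)^-1 *
  enorm (2 *: y t.+1 - x t - u) ^+ 2)%:E)%E) (z t.+1).
Proof. by have [_ /(_ t)[]] := DR. Qed.

Lemma DR_x t : x t.+1 = x t + (z t.+1 - y t.+1).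
Proof. by have [_ /(_ t)[]] := DR. Qed.

Lemma DR_g_fin t : g (z t.+1) \is a fin_num.
Proof. exact: prox_fin_num (DR_prox t). Qed.

Lemma DR_stationary t : x t = y t.+1 + gamma *: gradient f (y t.+1).
Proof. by have [_ /(_ t)[ymin _ _]] := DR; exact: prox_stationary. Qed.

Lemma lip_sqr u v :
  dot (gradient f u - gradient f v) (gradient f u - gradient f v) <=
  L ^+ 2 * dot (u - v) (u - v).
Proof.
rewrite -!enorm_sqr -exprMn ler_pXn2r ?nnegrE ?sqrtr_ge0//.
by rewrite mulr_ge0 ?sqrtr_ge0 ?ltW.
Qed.

(** The index shift matters: [x t.+1] was produced from [y t.+1] and is the
    point at which the step to [y t.+2] starts. *)
Lemma DR_decrease t :
  M t.+1 - M t <= ((1 + gamma * L) ^+ 2 + 5 * gamma * l / 2 - 3 / 2) / gamma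
    * enorm (y t.+2 - y t.+1) ^+ 2.
Proof.
have cvx := weakly_convex_gradient f_diff f_cvx.
rewrite /M (DR_x t.+1) enorm_sqr.
apply: (merit_decrease (L := L) (l := l) (b := gradient f (y t.+1))
  (b' := gradient f (y t.+2))) => //.
- by rewrite -DR_stationary -DR_x.
- exact: DR_stationary.
- exact: weakly_convex_hypomonotone cvx _ _.
- exact: lip_sqr.
- exact: (prox_le g_proper (DR_prox t.+1) (DR_g_fin t)).
Qed.

Let c := - (((1 + gamma * L) ^+ 2 + 5 * gamma * l / 2 - 3 / 2) / gamma).

Let c_gt0 : 0 < c.
Proof. by rewrite oppr_gt0 pmulr_llt0 ?invr_gt0. Qed.

Lemma merit_nonincreasing : nonincreasing_seq M.
Proof.
apply/nonincreasing_seqP => t; rewrite -subr_le0 (le_trans (DR_decrease t))//.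
by rewrite -oppr_ge0 -mulNr mulr_ge0 ?sqr_ge0// ltW.
Qed.

(** [x t.+1 - x t] is [d + gamma *: e] for the increments [d] and [e] of [y]
    and of the gradient. *)
Lemma DR_step_le t : enorm (x t.+1 - x t) <=
  (1 + gamma * L) * enorm (y t.+2 - y t.+1).
Proof.
have lip := lip_sqr (y t.+2) (y t.+1).
have le := lip_dot_le L_gt0 lip.
have gL : 0 <= 1 + gamma * L by rewrite addr_ge0// mulr_ge0 ?ltW.
rewrite -(@ler_pXn2r _ 2) ?nnegrE ?mulr_ge0 ?sqrtr_ge0// exprMn !enorm_sqr.
rewrite (_ : x t.+1 - x t = (y t.+2 - y t.+1)
    + gamma *: (gradient f (y t.+2) - gradient f (y t.+1))); last first.
  rewrite !DR_stationary; move: (gradient f _) (gradient f _) => a b.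
  by apply/rowP => i; rewrite !mxE; ring.
move: (y t.+2 - y t.+1) (gradient f _ - gradient f _) lip le => d e lip le.
rewrite !dotE (dotC e d).
have h1 : gamma * (gamma * dot e e) <= gamma * (gamma * (L ^+ 2 * dot d d)).
  by rewrite !ler_pM2l.
have h2 : gamma * dot d e <= gamma * (L * dot d d) by rewrite ler_pM2l.
lra.
Qed.

Section Cluster.
Variables ys zs xs : 'rV[R]_n.
Hypothesis clus : cluster ((y t.+1, z t.+1, x t.+1) @[t --> \oo]) (ys, zs, xs).

Lemma DR_subsequence : exists phi : nat -> nat, (forall k, (k <= phi k)%N) /\
  [/\ y (phi k).+1 @[k --> \oo] --> ys, z (phi k).+1 @[k --> \oo] --> zs &
      x (phi k).+1 @[k --> \oo] --> xs].
Proof.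
have [phi [phi_ge cphi]] := cluster_subsequence clus.
exists phi; split=> //; split.
- by apply: (cvg_comp _ fst (cvg_comp _ fst cphi cvg_fst)); exact: cvg_fst.
- by apply: (cvg_comp _ snd (cvg_comp _ fst cphi cvg_fst)); exact: cvg_snd.
- by apply: (cvg_comp _ snd cphi); exact: cvg_snd.
Qed.

(** The z-step ending at time [t.+1] starts from [x t], so limits along the
    subsequence are needed one index earlier for [x]. *)
Lemma sub_DR_x phi :
  y (phi k).+1 @[k --> \oo] --> ys -> z (phi k).+1 @[k --> \oo] --> zs ->
  x (phi k).+1 @[k --> \oo] --> xs ->
  x (phi k) @[k --> \oo] --> xs - (zs - ys).
Proof.
move=> cy cz cx.
rewrite (_ : (fun k => x (phi k)) =
  (fun k => x (phi k).+1 - (z (phi k).+1 - y (phi k).+1))); last first.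
  by apply/funext => k; rewrite DR_x addrK.
by apply: cvgB => //; apply: cvgB.
Qed.

(** The centre [2 *: y t.+1 - x t] of the z-step converges along the
    subsequence, as [prox_closed] requires. *)
Lemma sub_DR_g phi :
  y (phi k).+1 @[k --> \oo] --> ys -> z (phi k).+1 @[k --> \oo] --> zs ->
  x (phi k).+1 @[k --> \oo] --> xs ->
  g zs \is a fin_num /\ G (phi k) @[k --> \oo] --> fine (g zs).
Proof.
move=> cy cz cx; apply: (prox_closed g_proper g_closed
  (w := fun k => 2 *: y (phi k).+1 - x (phi k))
  (ws := 2 *: ys - (xs - (zs - ys))) _ _ cz) => [k|].
  exact: DR_prox.
by apply: cvgB; [exact: cvgZr|exact: sub_DR_x].
Qed.

(** The limit of the merit along the subsequence is a lower bound of the whole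
    nonincreasing sequence; consecutive merits therefore approach each other,
    and their difference dominates a multiple of the squared step. *)
Lemma DR_dy_cvg0 : enorm (y t.+2 - y t.+1) @[t --> \oo] --> (0 : R).
Proof.
have [phi [phi_ge [cy cz cx]]] := DR_subsequence.
have [_ cg] := sub_DR_g cy cz cx.
have cf : f (y (phi k).+1) @[k --> \oo] --> f ys.
  by apply: continuous_cvg cy; exact: differentiable_continuous.
have cM : M (phi k) @[k --> \oo] --> merit (f ys) (fine (g zs)) gamma ys zs xs.
  exact: cvg_merit.
have lb t : merit (f ys) (fine (g zs)) gamma ys zs xs <= M t.
  apply: (cvgr_to_le cM); exists t => // k /= tk.
  by apply: merit_nonincreasing; exact: leq_trans (phi_ge k).
have dM := nonincreasing_sub_cvg0 merit_nonincreasing lb.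
have dy2 : enorm (y t.+2 - y t.+1) ^+ 2 @[t --> \oo] --> (0 : R).
  have cdM : c^-1 * (M t - M t.+1) @[t --> \oo] --> (0 : R).
    by rewrite -(mulr0 c^-1); apply: cvgMr.
  apply: (squeeze_cvgr _ (cvg_cst 0) cdM); apply: nearW => t.
  rewrite sqr_ge0/= ler_pdivlMl// -lerN2 opprB -mulNr /c opprK.
  exact: DR_decrease.
rewrite -(sqrtr0 R).
rewrite (_ : (fun t => _) =
  (fun t => Num.sqrt (enorm (y t.+2 - y t.+1) ^+ 2))); last first.
  by apply/funext => t; rewrite sqrtr_sqr ger0_norm ?sqrtr_ge0.
by apply: (@continuous_cvg _ _ _ _ _ _ (@Num.sqrt R)) dy2; exact: sqrt_continuous.
Qed.

Lemma DR_dx_cvg0 : enorm (x t.+1 - x t) @[t --> \oo] --> (0 : R).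
Proof.
have cd : (1 + gamma * L) * enorm (y t.+2 - y t.+1) @[t --> \oo] --> (0 : R).
  by rewrite -(mulr0 (1 + gamma * L)); apply: cvgMr; exact: DR_dy_cvg0.
apply: (squeeze_cvgr _ (cvg_cst 0) cd); apply: nearW => t.
by rewrite sqrtr_ge0/= DR_step_le.
Qed.

Lemma DR_zy_cvg0 : enorm (z t.+1 - y t.+1) @[t --> \oo] --> (0 : R).
Proof.
rewrite (_ : (fun t => _) = (fun t => enorm (x t.+1 - x t))).
  exact: DR_dx_cvg0.
by apply/funext => t; rewrite DR_x addrAC subrr add0r.
Qed.

(** The limit of the subgradients is [(ys - xs) / gamma], which the limit of
    [DR_stationary] identifies with [- gradient f ys]. *)
Lemma DR_cluster_stationary :
  zs = ys /\ [set gradient f zs + v | v in limiting_subdiff g zs] 0.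
Proof.
have [phi [phi_ge [cy cz cx]]] := DR_subsequence.
have zy : zs = ys.
  apply/eqP; rewrite -subr_eq0; apply/eqP.
  apply: (@cvg_unique _ (@norm_hausdorff R 'rV[R]_n)
    ((z (phi k).+1 - y (phi k).+1) @[k --> \oo])); first exact: cvgB.
  apply: (cvg_comp _ (fun t => z t.+1 - y t.+1) (le_cvg_infty phi_ge)).
  exact: enorm_cvg0 DR_zy_cvg0.
split=> //.
have [gfin cg] := sub_DR_g cy cz cx.
have cx' := sub_DR_x cy cz cx.
have xsE : xs - (zs - ys) = ys + gamma *: gradient f ys.
  apply: (@cvg_unique _ (@norm_hausdorff R 'rV[R]_n) (x (phi k) @[k --> \oo])) => //.
  rewrite (_ : (fun k => x (phi k)) = (fun k => y (phi k).+1 +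
    gamma *: gradient f (y (phi k).+1))); last first.
    by apply/funext => k; rewrite -DR_stationary.
  by apply: cvgD => //; apply: cvgZr; apply: continuous_cvg cy; exact: f_C1.
exists (- gradient f zs); last by rewrite subrr.
split=> //; exists (fun k => z (phi k).+1),
  (fun k => gamma^-1 *: (2 *: y (phi k).+1 - x (phi k) - z (phi k).+1)); split.
- exact: cz.
- rewrite -(fineK gfin); apply/fine_cvgP; split; last exact: cg.
  by apply: nearW => k; exact: DR_g_fin.
- rewrite (_ : - gradient f zs = gamma^-1 *: (2 *: ys - (xs - (zs - ys)) - zs)).
    by apply: cvgZr; apply: cvgB => //; apply: cvgB => //; exact: cvgZr.
  rewrite xsE zy; move: (gradient f ys) => a.
  by apply/rowP => i; rewrite !mxE; field; exact: lt0r_neq0.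
- by move=> k; apply: prox_frechet => //; exact: DR_prox.
Qed.
End Cluster.
End Iterates.

Theorem theorem1 (R : realType) (n : nat)
    (f : 'rV[R]_n -> R) (g : 'rV[R]_n -> \bar R) (L l gamma : R)
    (L_gt0 : 0 < L) (gamma_gt0 : 0 < gamma)
    (f_diff : forall u, differentiable f u)
    (f_C1 : continuous (gradient f))
    (f_lip : forall u v,
       enorm (gradient f u - gradient f v) <= L * enorm (u - v))
    (f_cvx : @convex_function R 'rV[R]_n [set: 'rV[R]_n]
       (fun u => f u + l / 2 * enorm u ^+ 2))
    (g_proper : proper g)
    (g_closed : lower_semicontinuous g)
    (g_prox : forall w : 'rV[R]_n, exists u : 'rV[R]_n,
       argmin (fun u => (gamma%:E * g u + (2^-1 * enorm (u - w) ^+ 2)%:E)%E) u)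
    (x0 : 'rV[R]_n) (y z x : nat -> 'rV[R]_n)
    (DR : DR_sequence f g gamma x0 y z x)
    (gamma_small :
       (1 + gamma * L) ^+ 2 + 5 * gamma * l / 2 - 3 / 2 < 0) :
  let cluster_points : set ('rV[R]_n * 'rV[R]_n * 'rV[R]_n) :=
    cluster ((y t.+1, z t.+1, x t.+1) @[t --> \oo]) in
  [/\ nonincreasing_seq
        (fun t : nat => DR_merit f g gamma (y t.+1) (z t.+1) (x t.+1)),
      cluster_points !=set0 ->
        enorm (x t.+1 - x t) @[t --> \oo] --> (0 : R) /\
        enorm (z t.+1 - y t.+1) @[t --> \oo] --> (0 : R) &
      forall ys zs xs : 'rV[R]_n, cluster_points (ys, zs, xs) ->
        zs = ys /\
        [set gradient f zs + v | v in limiting_subdiff g zs] 0].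
Proof.
move=> cluster_points; split.
- move=> s t st; rewrite /= !DR_meritE ?(DR_g_fin g_proper DR)// lee_fin.
  exact: (merit_nonincreasing L_gt0 gamma_gt0 f_diff f_lip f_cvx g_proper DR).
- move=> [[[ys zs] xs] clus]; split.
    exact: (DR_dx_cvg0 L_gt0 gamma_gt0 f_diff f_lip f_cvx
      g_proper g_closed DR gamma_small clus).
  exact: (DR_zy_cvg0 L_gt0 gamma_gt0 f_diff f_lip f_cvx
      g_proper g_closed DR gamma_small clus).
- by move=> ys zs xs; exact: (DR_cluster_stationary L_gt0 gamma_gt0 f_diff f_C1
    f_lip f_cvx
    g_proper g_closed DR gamma_small).
Qed.
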